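(* Let $N\ge 2$ and let $\rho$ be a density operator on a finite-dimensional Hilbert space $H_1\otimes H_2\otimes\cdots\otimes H_N$. For a nonempty proper subset $\gamma\subset\{1,\dots,N\}$ with complement $\gamma'$, define the $\gamma$-discord $$\mathcal{D}_\gamma(\rho)=\min\Big[S\big(\rho\,\|\,\Phi^{\gamma}(\rho)\big)-S\big(\rho_\gamma\,\|\,\Phi_\gamma(\rho_\gamma)\big)-S\big(\rho_{\gamma'}\,\|\,\Phi_{\gamma'}(\rho_{\gamma'})\big)\Big],$$ where the minimum is over all complete sets $\{\Pi_\gamma^k\}_k$ of rank-one orthogonal projectors on $H_\gamma=\bigotimes_{i\in\gamma}H_i$ and $\{\Pi_{\gamma'}^{k'}\}_{k'}$ on $H_{\gamma'}=\bigotimes_{i\in\gamma'}H_i$, and $\Phi^{\gamma}(\rho)=\sum_{k,k'}(\Pi_{\gamma}^{k}\otimes\Pi_{\gamma'}^{k'})\rho(\Pi_{\gamma}^{k}\otimes\Pi_{\gamma'}^{k'})$, $\Phi_\gamma(\rho_\gamma)=\sum_k\Pi_\gamma^k\rho_\gamma\Pi_\gamma^k$, $\Phi_{\gamma'}(\rho_{\gamma'})=\sum_{k'}\Pi_{\gamma'}^{k'}\rho_{\gamma'}\Pi_{\gamma'}^{k'}$. Define the genuine multipartite quantum discord $\mathcal{D}(\rho)=\min_\gamma \mathcal{D}_\gamma(\rho)$, the minimum over all nonempty proper subsets $\gamma$. Then $\mathcal{D}(\rho)\ge 0$.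
   Context: $S(\rho\|\sigma)=\mathrm{Tr}(\rho\log_2\rho-\rho\log_2\sigma)$ is the quantum relative entropy. $\rho_\gamma$ and $\rho_{\gamma'}$ denote the reduced density operators of $\rho$ on the subsystems indexed by $\gamma$ and $\gamma'$ (partial traces over the complementary factors). *)

(* Defs.v *)
From HB Require Import structures.
From mathcomp Require Import all_boot all_order all_algebra.
From mathcomp Require Import complex.
From mathcomp Require Import boolp classical_sets reals ereal exp.

Set Implicit Arguments.
Unset Strict Implicit.
Unset Printing Implicit Defensive.

Import Order.TTheory GRing.Theory Num.Theory.
Local Open Scope ring_scope.

Section Quantum.
Variable R : realType.
Local Notation C := R[i].

Definition adj m n (A : 'M[C]_(m, n)) : 'M[C]_(n, m) := (map_mx conjc A)^T.

(* log base 2 on reals, with the convention log2 x = 0 for x <= 0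
   (only used for 0 eigenvalues, where it multiplies zero weights) *)
Definition log2 (x : R) : R := if 0 < x then ln x / ln 2 else 0.

(* Matrix logarithm (base 2) of a normal (here: positive semidefinite) matrix,
   defined through the spectral decomposition A = U^-1 diag(a) U of
   spectral.v (U unitary): log2 A = U^* diag(log2 a) U, with log2 0 := 0 on
   the kernel. *)
Definition mlog2 n (A : 'M[C]_n) : 'M[C]_n :=
  let U := spectralmx A in
  adj U *m diag_mx (map_mx (fun z : C => Complex (log2 (complex.Re z)) 0) (spectral_diag A)) *m U.

(* support of rho contained in support of sigma  <=>  ker sigma <= ker rho *)
Definition supp_incl n (rho sigma : 'M[C]_n) : Prop :=
  forall v : 'cV[C]_n, sigma *m v = 0 -> rho *m v = 0.

Definition rel_entropy n (rho sigma : 'M[C]_n) : \bar R :=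
  if `[< supp_incl rho sigma >] then
    (complex.Re (\tr (rho *m (mlog2 rho - mlog2 sigma))))%:E
  else +oo%E.

Definition density n (rho : 'M[C]_n) : Prop :=
  [/\ adj rho = rho,
      forall v : 'cV[C]_n, 0 <= (adj v *m rho *m v) 0 0
    & \tr rho = 1].

Definition complete_rank1_projs n m (P : 'I_m -> 'M[C]_n) : Prop :=
  [/\ forall k, adj (P k) = P k /\ P k *m P k = P k,
      forall k, \rank (P k) = 1%N,
      forall k l, k != l -> P k *m P l = 0
    & \sum_(k < m) P k = 1%:M].

Variables (N : nat) (d : 'I_N -> nat).

(* computational basis of H_1 (x) ... (x) H_N *)
Definition FullB := {dffun forall i : 'I_N, 'I_(d i)}.
(* computational basis of H_A = (x)_{i in A} H_i *)
Definition SubB (A : {set 'I_N}) := {dffun forall i : {i : 'I_N | i \in A}, 'I_(d (val i))}.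

Definition dimF := #|{: FullB}|.
Definition dimS A := #|{: SubB A}|.

Definition res (A : {set 'I_N}) (x : FullB) : SubB A :=
  [ffun i : {i : 'I_N | i \in A} => x (val i)].

(* tensor product X (x) Y of an operator on H_g and one on H_g', as an operator
   on H (canonical identification H = H_g (x) H_g') *)
Definition tens (g : {set 'I_N}) (X : 'M[C]_(dimS g)) (Y : 'M[C]_(dimS (~: g)))
  : 'M[C]_dimF :=
  \matrix_(i, j)
    (X (enum_rank (res g (enum_val i))) (enum_rank (res g (enum_val j))) *
     Y (enum_rank (res (~: g) (enum_val i))) (enum_rank (res (~: g) (enum_val j)))).

(* reduced density operator rho_A (partial trace over the complement of A) *)
Definition ptrace (A : {set 'I_N}) (rho : 'M[C]_dimF) : 'M[C]_(dimS A) :=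
  \matrix_(a, b)
    \sum_(x : FullB) \sum_(y : FullB |
        [&& res A x == enum_val a, res A y == enum_val b & res (~: A) x == res (~: A) y])
      rho (enum_rank x) (enum_rank y).

Definition pinch n m (P : 'I_m -> 'M[C]_n) (A : 'M[C]_n) : 'M[C]_n :=
  \sum_(k < m) P k *m A *m P k.

Definition pinch2 (g : {set 'I_N}) m m' (P : 'I_m -> 'M[C]_(dimS g))
  (Q : 'I_m' -> 'M[C]_(dimS (~: g))) (rho : 'M[C]_dimF) : 'M[C]_dimF :=
  \sum_(k < m) \sum_(k' < m') tens (P k) (Q k') *m rho *m tens (P k) (Q k').

Definition discord_term (g : {set 'I_N}) m m' (P : 'I_m -> 'M[C]_(dimS g))
  (Q : 'I_m' -> 'M[C]_(dimS (~: g))) (rho : 'M[C]_dimF) : \bar R :=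
  (rel_entropy rho (pinch2 P Q rho)
   - rel_entropy (ptrace g rho) (pinch P (ptrace g rho))
   - rel_entropy (ptrace (~: g) rho) (pinch Q (ptrace (~: g) rho)))%E.

Definition gamma_discord (g : {set 'I_N}) (rho : 'M[C]_dimF) : \bar R :=
  ereal_inf [set v | exists m m' (P : 'I_m -> 'M[C]_(dimS g))
                        (Q : 'I_m' -> 'M[C]_(dimS (~: g))),
      [/\ complete_rank1_projs P, complete_rank1_projs Q
        & v = discord_term P Q rho]].

Definition gmqd (rho : 'M[C]_dimF) : \bar R :=
  \big[Order.min/+oo%E]_(g : {set 'I_N} | (g != finset.set0) && (g != [set: 'I_N]))
     gamma_discord g rho.

End Quantum.

(* Main.v *)
Require Import Defs.
From HB Require Import structures.
From mathcomp Require Import all_boot all_order all_algebra ring lra.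
From mathcomp Require Import sesquilinear spectral complex.
From mathcomp Require Import boolp classical_sets functions reals ereal.
From mathcomp Require Import topology normedtype derive realfun exp.

(** A discord term is the loss of mutual information
    [S(rho || rho_g (x) rho_g') - D(p || a (x) b)], where [p] is the outcome
    distribution of the local measurements and [a], [b] are its marginals, so
    it suffices that a measurement does not increase relative entropy.  Along
    the segment from [rho] to [sigma], writing [l], [m] for eigenvalues and [w]
    for squared overlaps,
      [d/du \sum w l (ln l - ln ((1-u) l + u m))
         = (1 - \sum w l m / ((1-u) l + u m)) / (1-u)],
    and the last sum is the minimum over operators [X] of the quadratic form
    [tr (X^* rho X) / u + tr ((1-X) sigma (1-X)^* ) / (1-u)].  Taking [X] diagonal
    in the measured basis bounds it by the same sum for the outcome
    distributions, whose relative entropy therefore grows more slowly in [u]. *)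

Set Implicit Arguments.
Unset Strict Implicit.
Unset Printing Implicit Defensive.
Import Order.TTheory GRing.Theory Num.Theory numFieldNormedType.Exports.
Local Open Scope ring_scope.

(** * Scalar inequalities along the segment *)

Lemma is_derive_sum_fin (R : realType) (I : finType) (h : I -> R -> R)
  (dh : I -> R) (x : R) :
  (forall i, is_derive x 1 (h i) (dh i)) ->
  is_derive x 1 (fun u => \sum_i h i u) (\sum_i dh i).
Proof.
move=> dhE; rewrite -fct_sumE.
apply: (big_ind2 (fun (f : R -> R) (d : R) => is_derive x 1 f d)) => [|f df g dg fD gD|i _].
- exact: is_derive_cst.
- exact: is_deriveD.
- exact: dhE.
Qed.

(* The coefficients [c] are signed: quantum weights enter positively, outcome
   probabilities negatively. *)
Lemma sum_ln_ratio_ge0 (R : realType) (I : finType) (c l m : I -> R) :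
  (forall i, 0 < l i) -> (forall i, 0 < m i) -> \sum_i c i = 0 ->
  (forall u : R, 0 < u < 1 -> \sum_i c i * (m i / ((1 - u) * l i + u * m i)) <= 0) ->
  0 <= \sum_i c i * (ln (l i) - ln (m i)).
Proof.
move=> l0 m0 c0 H.
pose D i u := (1 - u) * l i + u * m i.
have D0 i (u : R) : 0 <= u <= 1 -> 0 < D i u.
  move=> /andP[u0 u1]; rewrite /D; have := l0 i; have := m0 i.
  by have [->|] := eqVneq u 0; nra.
(* [g] vanishes at 0 and is the sum in the goal at 1, so it is enough that it is nondecreasing on
   [[0, 1]]. *)
pose g u := \sum_i c i * (ln (l i) - ln (D i u)).
have dD i (u : R) : is_derive u 1 (D i) (m i - l i).
  have -> : D i = cst (l i) + (m i - l i) \*: (@id R).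
    by apply/funext => v; rewrite /D /= !fctE /=; rewrite /GRing.scale /=; ring.
  by apply: is_derive_eq; rewrite /GRing.scale /=; ring.
have dg (u : R) : 0 <= u <= 1 ->
    is_derive u 1 g (\sum_i c i * ((l i - m i) / D i u)).
  move=> u01; apply: is_derive_sum_fin => i.
  have dl : is_derive (D i u) 1 (@ln R) (D i u)^-1 by apply: is_derive1_ln; exact: D0.
  have := is_derive1_comp dl (dD i u).
  move=> dc; have -> : (fun u => c i * (ln (l i) - ln (D i u))) =
     c i \*: (cst (ln (l i)) - (@ln R \o D i)) by apply/funext => v; rewrite /= !fctE.
  by apply: is_derive_eq; rewrite /GRing.scale /=; ring.
have := @ger0_derive1_ndecr R g 0 1 _ _ _ 0 1.
have -> : g 0 = 0.
  by apply: big1 => i _; rewrite /D subr0 mul1r mul0r addr0 subrr mulr0.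
have -> : g 1 = \sum_i c i * (ln (l i) - ln (m i)).
  by apply: eq_bigr => i _; rewrite /D subrr mul1r mul0r add0r.
apply => //.
- move=> u; rewrite in_itv /= => /andP[u0 u1].
  by apply: ex_derive; apply: dg; rewrite !ltW.
- move=> u; rewrite in_itv /= => /andP[u0 u1].
  have u01 : 0 <= u <= 1 by rewrite !ltW.
  rewrite derive1E (@derive_val _ _ _ _ _ _ _ (dg _ u01)).
  (* Since [D i u - m i = (1 - u) * (l i - m i)], each quotient is [(1 - m i / D i u) / (1 - u)].
     The constant parts cancel because the [c i] sum to zero, which leaves the sum controlled by
     [H]. *)
  have -> : \sum_i c i * ((l i - m i) / D i u) =
     (\sum_i c i - \sum_i c i * (m i / D i u)) / (1 - u).
    rewrite -sumrB mulr_suml; apply: eq_bigr => i _.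
    have := D0 i u u01; rewrite /D => Dp; field.
    by rewrite !gt_eqF // subr_gt0.
  by rewrite c0 sub0r divr_ge0 ?oppr_ge0 ?H ?u0 //; lra.
- apply: derivable_within_continuous => u; rewrite in_itv /= => u01.
  by apply: ex_derive; exact: dg.
Qed.

(** Completing the square in [x]: right side minus left side is a square over a positive
    denominator. When the denominator on the left vanishes, division by zero makes that side 0. *)
Lemma parallel_sum_le (R : realType) (l m u v x : R) :
  0 <= l -> 0 <= m -> 0 < u < 1 ->
  v ^+ 2 * (l * m / ((1 - u) * l + u * m)) <=
  l / u * x ^+ 2 + m / (1 - u) * (v - x) ^+ 2.
Proof.
move=> l0 m0 /andP[u0 u1].
have v0 : 0 < 1 - u by rewrite subr_gt0.
have [D0|] := eqVneq ((1 - u) * l + u * m) 0.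
  by rewrite D0 invr0 !mulr0 addr_ge0 // mulr_ge0 ?sqr_ge0 ?divr_ge0 // ltW.
move=> Dn0; have Dp : 0 < (1 - u) * l + u * m by rewrite lt_neqAle eq_sym Dn0; nra.
rewrite -subr_ge0.
set w := (X in 0 <= X).
have -> : w = ((1 - u) * l * x - u * m * (v - x)) ^+ 2 / (u * (1 - u) * ((1 - u) * l + u * m)).
  by rewrite /w; field; rewrite !gt_eqF.
by rewrite divr_ge0 ?sqr_ge0 // !mulr_ge0 ?ltW.
Qed.

(** * Trace inequalities *)

(* [C] stands for [R[i]], with [ofR], [re], [im] the inclusion and the real and
   imaginary parts.  It is kept abstract because the several canonical paths to
   the algebraic structures of [R[i]] block rewriting under big operators; the
   copies of the definitions of [Defs] made below ([hadj], [mxlog2], [mxpinch],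
   [mxtens], [mxptrace]) are convertible to the originals at [C := R[i]]. *)
Section Matrices.
Variables (R : realType) (C : numClosedFieldType).
Variables (ofR : {rmorphism R -> C}) (re im : C -> R).
Hypothesis ofRK : cancel ofR re.
Hypothesis re_Re : forall z, ofR (re z) = 'Re z.
Hypothesis im_Im : forall z, ofR (im z) = 'Im z.
Local Notation "x %:C" := (ofR x) : ring_scope.

Lemma reD (x y : C) : re (x + y) = re x + re y.
Proof. by apply: (fmorph_inj ofR); rewrite rmorphD /= !re_Re raddfD. Qed.

Lemma reN (x : C) : re (- x) = - re x.
Proof. by apply: (fmorph_inj ofR); rewrite rmorphN /= !re_Re raddfN. Qed.

Lemma imD (x y : C) : im (x + y) = im x + im y.
Proof. by apply: (fmorph_inj ofR); rewrite rmorphD /= !im_Im raddfD. Qed.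

Lemma imN (x : C) : im (- x) = - im x.
Proof. by apply: (fmorph_inj ofR); rewrite rmorphN /= !im_Im raddfN. Qed.

Lemma reM (x y : C) : re (x * y) = re x * re y - im x * im y.
Proof.
by apply: (fmorph_inj ofR); rewrite rmorphB !rmorphM /= !re_Re !im_Im ReM.
Qed.

Lemma ofR_real (a : R) : a%:C \is Num.real.
Proof. by rewrite -[a]ofRK re_Re Creal_Re. Qed.

Lemma imC (a : R) : im a%:C = 0.
Proof.
by apply: (fmorph_inj ofR); rewrite im_Im rmorph0; exact/Creal_ImP/ofR_real.
Qed.

Lemma conj_ofR (a : R) : (a%:C)^* = a%:C.
Proof. exact/CrealP/ofR_real. Qed.

Lemma re_conj (x : C) : re x^* = re x.
Proof. by apply: (fmorph_inj ofR); rewrite !re_Re Re_conj. Qed.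

Lemma im_conj (x : C) : im x^* = - im x.
Proof. by apply: (fmorph_inj ofR); rewrite rmorphN /= !im_Im Im_conj. Qed.

Lemma reim_eq (x y : C) : re x = re y -> im x = im y -> x = y.
Proof. by move=> xy1 xy2; apply/eqCP; rewrite -!re_Re -!im_Im xy1 xy2. Qed.

Definition hadj m n (A : 'M[C]_(m, n)) : 'M[C]_(n, m) := (map_mx Num.conj A)^T.

Lemma hadjK m n (A : 'M[C]_(m, n)) : hadj (hadj A) = A.
Proof. by apply/matrixP => i j; rewrite !mxE conjCK. Qed.

Lemma hadjM m n p (A : 'M[C]_(m, n)) (B : 'M[C]_(n, p)) :
  hadj (A *m B) = hadj B *m hadj A.
Proof. by rewrite /hadj map_mxM trmx_mul. Qed.

Lemma hadjZ m n (a : R) (A : 'M[C]_(m, n)) : hadj (a%:C *: A) = a%:C *: hadj A.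
Proof. by apply/matrixP => i j; rewrite !mxE rmorphM /= conj_ofR. Qed.

Lemma hadj_sum m n (I : finType) (A : I -> 'M[C]_(m, n)) :
  hadj (\sum_i A i) = \sum_i hadj (A i).
Proof.
apply/matrixP => i j; rewrite !(mxE, summxE) rmorph_sum.
by apply: eq_bigr => k _; rewrite !mxE.
Qed.

Lemma hadj1 n : hadj (1%:M : 'M[C]_n) = 1%:M.
Proof. by rewrite /hadj map_mx1 trmx1. Qed.

Lemma mxtrace_hadj n (A : 'M[C]_n) : \tr (hadj A) = (\tr A)^*.
Proof. by rewrite /hadj mxtrace_tr /mxtrace rmorph_sum; apply: eq_bigr => i _; rewrite mxE. Qed.

Definition rtr n (A : 'M[C]_n) : R := re (\tr A).

Lemma Re_sum (I : Type) (r : seq I) (Q : pred I) (z : I -> C) :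
  re (\sum_(i <- r | Q i) z i) = \sum_(i <- r | Q i) re (z i).
Proof. by apply: (big_morph _ reD); rewrite -(rmorph0 ofR) ofRK. Qed.

Lemma rtr_sum n (I : finType) (A : I -> 'M[C]_n) :
  rtr (\sum_i A i) = \sum_i rtr (A i).
Proof. by rewrite /rtr raddf_sum Re_sum. Qed.

Lemma rtrB n (A B : 'M[C]_n) : rtr (A - B) = rtr A - rtr B.
Proof. by rewrite /rtr raddfB /= reD reN. Qed.

Lemma rtrZ n (a : R) (A : 'M[C]_n) : rtr (a%:C *: A) = a * rtr A.
Proof. by rewrite /rtr mxtraceZ reM ofRK imC mul0r subr0. Qed.

Lemma rtrC m n (A : 'M[C]_(m, n)) (B : 'M[C]_(n, m)) : rtr (A *m B) = rtr (B *m A).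
Proof. by rewrite /rtr mxtrace_mulC. Qed.

Lemma rtr_comb_mul n (I : finType) (a : I -> R) (E : I -> 'M[C]_n) (B : 'M[C]_n) :
  rtr ((\sum_i (a i)%:C *: E i) *m B) = \sum_i a i * rtr (E i *m B).
Proof.
rewrite mulmx_suml (@rtr_sum n I); apply: eq_bigr => i _.
by rewrite -scalemxAl rtrZ.
Qed.

Lemma mxtrace_hermM n (A B : 'M[C]_n) : hadj A = A -> hadj B = B ->
  \tr (A *m B) = (rtr (A *m B))%:C.
Proof.
move=> hA hB; have trE : (\tr (A *m B))^* = \tr (A *m B).
  by rewrite -mxtrace_hadj hadjM hA hB mxtrace_mulC.
apply: reim_eq; rewrite ?ofRK ?imC //.
by have := congr1 im trE; rewrite im_conj; lra.
Qed.

(** The squared Hilbert-Schmidt norm. *)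
Definition hs m n (A : 'M[C]_(m, n)) : R := rtr (A *m hadj A).

Lemma hsE m n (A : 'M[C]_(m, n)) :
  hs A = \sum_i \sum_j (re (A i j) ^+ 2 + im (A i j) ^+ 2).
Proof.
rewrite /hs /rtr /mxtrace Re_sum; apply: eq_bigr => i _.
rewrite mxE Re_sum; apply: eq_bigr => j _; rewrite !mxE.
by rewrite reM re_conj im_conj mulrN opprK !expr2.
Qed.

Lemma hs_ge0 m n (A : 'M[C]_(m, n)) : 0 <= hs A.
Proof. by rewrite hsE; do 2 (apply: sumr_ge0 => ? _); rewrite addr_ge0 ?sqr_ge0. Qed.

Lemma hs_eq0 m n (A : 'M[C]_(m, n)) : hs A = 0 -> A = 0.
Proof.
have sq0 (a : R) := sqr_ge0 a.
rewrite hsE => /eqP; rewrite psumr_eq0 => [/allP A0|i _]; last first.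
  by apply: sumr_ge0 => ? _; rewrite addr_ge0.
apply/matrixP => i j; have := A0 i (mem_index_enum i).
rewrite psumr_eq0 => [/allP/(_ j (mem_index_enum j))|? _]; last by rewrite addr_ge0.
rewrite /= paddr_eq0 // !sqrf_eq0 mxE => /andP[/eqP a0 /eqP b0].
have z0 : re 0 = 0 /\ im 0 = 0 by rewrite -(rmorph0 ofR) ofRK imC.
by case: z0 => r0 i0; apply: reim_eq; rewrite ?r0 ?i0.
Qed.

(** Ranks are left free, so that one notion covers eigenprojections, local measurements and products
    of either on the full space. *)
Definition projfam (I : finType) n (P : I -> 'M[C]_n) : Prop :=
  [/\ forall k, hadj (P k) = P k,
      forall k l, P k *m P l = if k == l then P k else 0
    & \sum_k P k = 1%:M].

(** [hs] is the sum of the squared real and imaginary parts of the entries, and the scalar bound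
    applies to each of them separately. *)
Lemma hs_parallel_le m n (l mu u : R) (V X : 'M[C]_(m, n)) :
  0 <= l -> 0 <= mu -> 0 < u < 1 ->
  hs V * (l * mu / ((1 - u) * l + u * mu)) <=
  l / u * hs X + mu / (1 - u) * hs (V - X).
Proof.
move=> l0 m0 u01; rewrite !hsE mulr_suml !mulr_sumr -big_split /=.
apply: ler_sum => i _; rewrite mulr_suml !mulr_sumr -big_split /=.
apply: ler_sum => j _; rewrite !mxE reD reN imD imN.
have := parallel_sum_le (re (V i j)) (re (X i j)) l0 m0 u01.
have := parallel_sum_le (im (V i j)) (im (X i j)) l0 m0 u01.
rewrite !mulrDl !mulrDr => h1 h2.
by apply: le_trans (lerD h2 h1) _; rewrite addrACA.
Qed.

Section Family.
Variables (I : finType) (n : nat) (P : I -> 'M[C]_n).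
Hypothesis famP : projfam P.

Lemma projfam_idem k : P k *m P k = P k.
Proof. by case: famP => _ -> _; rewrite eqxx. Qed.

Lemma projfam_comb_mull (a : I -> C) k :
  (\sum_i a i *: P i) *m P k = a k *: P k.
Proof.
rewrite mulmx_suml (bigD1 k) //= -scalemxAl projfam_idem big1 ?addr0 // => i ik.
by case: famP => _ PP _; rewrite -scalemxAl PP (negPf ik) scaler0.
Qed.

Lemma projfam_comb_sq (x : I -> R) :
  (\sum_i (x i)%:C *: P i) *m (\sum_i (x i)%:C *: P i) = \sum_i (x i ^+ 2)%:C *: P i.
Proof.
rewrite mulmx_sumr; apply: eq_bigr => i _.
by rewrite -scalemxAr projfam_comb_mull scalerA -rmorphM -expr2.
Qed.

Lemma projfam_comb_herm (x : I -> R) :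
  hadj (\sum_i (x i)%:C *: P i) = \sum_i (x i)%:C *: P i.
Proof. by rewrite hadj_sum; apply: eq_bigr => i _; case: famP => hP _ _; rewrite hadjZ hP. Qed.

Lemma projfam_comb_onem (x : I -> R) :
  1%:M - \sum_i (x i)%:C *: P i = \sum_i (1 - x i)%:C *: P i.
Proof.
case: famP => _ _ <-; rewrite -sumrB; apply: eq_bigr => i _.
by rewrite rmorphB rmorph1 scalerBl scale1r.
Qed.

Lemma rtr_projfam (A : 'M[C]_n) : rtr A = \sum_k rtr (P k *m A).
Proof. by rewrite -rtr_sum -mulmx_suml; case: famP => _ _ ->; rewrite mul1mx. Qed.

End Family.

Lemma rtr_proj_ge0 n (P Q : 'M[C]_n) : hadj P = P -> P *m P = P ->
  hadj Q = Q -> Q *m Q = Q -> rtr (P *m Q) = hs (P *m Q).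
Proof.
move=> hP pP hQ pQ.
by rewrite /hs hadjM hP hQ -mulmxA (mulmxA Q) pQ [RHS]rtrC -mulmxA pP rtrC.
Qed.

Lemma hs_sandwich n (P X Q : 'M[C]_n) : hadj P = P -> P *m P = P ->
  hadj Q = Q -> Q *m Q = Q -> hadj X = X -> hs (P *m X *m Q) = rtr (P *m (X *m Q *m X)).
Proof.
move=> hP pP hQ pQ hX.
rewrite /hs !hadjM hP hQ hX -!mulmxA (mulmxA Q Q) pQ.
by rewrite [LHS]rtrC -!mulmxA pP !mulmxA [LHS]rtrC !mulmxA.
Qed.

(** * Relative entropy under a measurement *)

Section Measured.
Variables (I J K : finType) (n : nat).
Variables (E : I -> 'M[C]_n) (F : J -> 'M[C]_n) (P : K -> 'M[C]_n).
Variables (l : I -> R) (mu : J -> R).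
Hypothesis famE : projfam E.
Hypothesis famF : projfam F.
Hypothesis famP : projfam P.
Hypothesis l0 : forall i, 0 <= l i.
Hypothesis mu0 : forall j, 0 <= mu j.
Let rho := \sum_i (l i)%:C *: E i.
Let sigma := \sum_j (mu j)%:C *: F j.
Let p k := rtr (P k *m rho).
Let q k := rtr (P k *m sigma).
Let w i j := rtr (E i *m F j).

Lemma rtr_proj_comb_ge0 (I' : finType) (E' : I' -> 'M[C]_n) (a : I' -> R) (Q : 'M[C]_n) :
  projfam E' -> (forall i, 0 <= a i) -> hadj Q = Q -> Q *m Q = Q ->
  0 <= rtr (Q *m \sum_i (a i)%:C *: E' i).
Proof.
move=> famE' a0 hQ pQ; case: (famE') => hE' _ _.
rewrite rtrC rtr_comb_mul; apply: sumr_ge0 => i _.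
by rewrite mulr_ge0 // rtr_proj_ge0 ?hs_ge0 ?projfam_idem.
Qed.

(* [l m / ((1 - u) l + u m)] is the minimum over [X] of a quadratic form; the
   operator [X] diagonal for the measurement [P] is a competitor on the
   quantum side and is optimal on the classical side. *)
Lemma parallel_sum_measured (u : R) : 0 < u < 1 ->
  \sum_i \sum_j w i j * (l i * mu j / ((1 - u) * l i + u * mu j)) <=
  \sum_k p k * q k / ((1 - u) * p k + u * q k).
Proof.
move=> u01; have /andP[u0 u1] := u01.
have hE i : hadj (E i) = E i by case: famE.
have hF i : hadj (F i) = F i by case: famF.
have hP i : hadj (P i) = P i by case: famP.
have idE := projfam_idem famE; have idF := projfam_idem famF.
have idP := projfam_idem famP.
have p0 k : 0 <= p k by exact: rtr_proj_comb_ge0.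
have q0 k : 0 <= q k by exact: rtr_proj_comb_ge0.
(* The minimiser of [p k * x ^+ 2 / u + q k * (1 - x) ^+ 2 / (1 - u)], found by setting the
   derivative in [x] to zero. *)
pose x k := u * q k / ((1 - u) * p k + u * q k).
pose X := \sum_k (x k)%:C *: P k.
pose Y := \sum_k (1 - x k)%:C *: P k.
have YE : 1%:M - X = Y by exact: projfam_comb_onem.
have hX : hadj X = X by exact: projfam_comb_herm.
have hY : hadj Y = Y by exact: projfam_comb_herm.
have XX : X *m X = \sum_k (x k ^+ 2)%:C *: P k by exact: projfam_comb_sq.
have YY : Y *m Y = \sum_k ((1 - x k) ^+ 2)%:C *: P k by exact: projfam_comb_sq.
clearbody X Y.
apply: (@le_trans _ _ (\sum_i \sum_j (l i / u * hs (E i *m X *m F j)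
    + mu j / (1 - u) * hs (E i *m Y *m F j)))).
  apply: ler_sum => i _; apply: ler_sum => j _.
  rewrite /w rtr_proj_ge0 //.
  have -> : E i *m Y *m F j = E i *m F j - E i *m X *m F j.
    by rewrite -YE mulmxBr mulmx1 mulmxBl.
  exact: hs_parallel_le.
under eq_bigr do rewrite big_split.
rewrite big_split /= [X in _ + X]exchange_big /=.
have -> : \sum_i \sum_j l i / u * hs (E i *m X *m F j) = \sum_k x k ^+ 2 * p k / u.
  transitivity (rtr (rho *m (X *m X)) / u).
    rewrite rtr_comb_mul mulr_suml; apply: eq_bigr => i _.
    rewrite -mulr_sumr mulrAC; congr (_ * _ / _).
    (* Inserting the resolution of identity [F] between the two factors splits the trace into the
       squared norms of the [E i *m X *m F j]. *)
    have -> : X *m X = X *m (\sum_j F j) *m X by case: famF => _ _ ->; rewrite mulmx1.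
    rewrite mulmx_sumr mulmx_suml mulmx_sumr rtr_sum; apply: eq_bigr => j _.
    by rewrite hs_sandwich.
  by rewrite XX rtrC rtr_comb_mul mulr_suml.
have -> : \sum_j \sum_i mu j / (1 - u) * hs (E i *m Y *m F j)
    = \sum_k (1 - x k) ^+ 2 * q k / (1 - u).
  transitivity (rtr (sigma *m (Y *m Y)) / (1 - u)).
    rewrite rtr_comb_mul mulr_suml; apply: eq_bigr => j _.
    rewrite -mulr_sumr mulrAC; congr (_ * _ / _).
    rewrite mulmxA rtrC (rtr_projfam famE) mulmxA; apply: eq_bigr => i _.
    by rewrite hs_sandwich.
  by rewrite YY rtrC rtr_comb_mul mulr_suml.
rewrite -big_split /=; apply: ler_sum => k _; rewrite /x.
have [D0|Dn0] := eqVneq ((1 - u) * p k + u * q k) 0.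
  have [-> ->] : p k = 0 /\ q k = 0 by have := p0 k; have := q0 k; nra.
  by rewrite !(mulr0, mul0r, addr0).
rewrite le_eqVlt; apply/orP; left; apply/eqP; field.
by rewrite Dn0 !gt_eqF // subr_gt0.
Qed.

(** Both sides become one signed sum over [(I * J) + K], to which [sum_ln_ratio_ge0] applies: the
    weights cancel because each side has total weight [rtr rho], and the sign condition is
    [parallel_sum_measured]. The two hypotheses are the support inclusions that keep every logarithm
    with nonzero weight away from 0. *)
Lemma measured_relative_entropy_le :
  (forall i j, w i j != 0 -> l i != 0 -> mu j != 0) ->
  (forall k, p k != 0 -> q k != 0) ->
  \sum_k p k * (log2 (p k) - log2 (q k)) <=
  \sum_i \sum_j l i * w i j * (log2 (l i) - log2 (mu j)).
Proof.
move=> suppl suppp.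
have hP i : hadj (P i) = P i by case: famP.
have idP := projfam_idem famP.
have p0 k : 0 <= p k by exact: rtr_proj_comb_ge0.
have q0 k : 0 <= q k by exact: rtr_proj_comb_ge0.
pose c (s : (I * J) + K) :=
  match s with inl t => l t.1 * w t.1 t.2 | inr k => - p k end.
(* The value 1 is a placeholder for terms of weight zero: it makes [a] and [b] strictly positive
   everywhere without changing the weighted sum. *)
pose a (s : (I * J) + K) := if c s == 0 then 1 else
  match s with inl t => l t.1 | inr k => p k end.
pose b (s : (I * J) + K) := if c s == 0 then 1 else
  match s with inl t => mu t.2 | inr k => q k end.
have ap s : 0 < a s.
  rewrite /a; case: eqVneq => // cs; rewrite lt_neqAle eq_sym.
  by case: s cs => [[i j]|k] /=; rewrite ?oppr_eq0 ?mulf_eq0 ?negb_or ?l0 ?p0 andbT // => /andP[->].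
have bp s : 0 < b s.
  rewrite /b; case: eqVneq => // cs; rewrite lt_neqAle eq_sym.
  case: s cs => [[i j]|k] /=; rewrite ?oppr_eq0 ?mulf_eq0 ?negb_or ?mu0 ?q0 andbT.
    by move=> /andP[? ?]; exact: (@suppl i).
  exact: suppp.
have sumc0 : \sum_s c s = 0.
  rewrite big_sumType /= sumrN; apply/eqP; rewrite subr_eq0; apply/eqP.
  rewrite -(pair_bigA _ (fun i j => l i * w i j)) /= /p -(rtr_projfam famP).
  rewrite /rho rtr_sum; apply: eq_bigr => i _; rewrite -mulr_sumr rtrZ.
  by rewrite (rtr_projfam famF); congr (_ * _); apply: eq_bigr => j _; rewrite rtrC.
have := sum_ln_ratio_ge0 ap bp sumc0.
have par (u : R) : 0 < u < 1 -> \sum_s c s * (b s / ((1 - u) * a s + u * b s)) <= 0.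
  move=> u01; rewrite big_sumType /=.
  rewrite -(pair_bigA _ (fun i j => c (inl (i, j)) * (b (inl (i, j)) /
    ((1 - u) * a (inl (i, j)) + u * b (inl (i, j)))))) /=.
  have := parallel_sum_measured u01.
  rewrite -subr_le0; congr (_ <= 0); rewrite -sumrN; congr (_ + _).
    apply: eq_bigr => i _; apply: eq_bigr => j _.
    rewrite /a /b /=; have [/eqP|] := eqVneq (l i * w i j) 0.
      rewrite mulf_eq0 => /orP[] /eqP ->; by rewrite !(mulr0, mul0r).
    by rewrite !mulrA (mulrC (w i j)).
  apply: eq_bigr => k _; rewrite /a /b /= oppr_eq0.
  by case: eqVneq => [->|_]; rewrite ?mul0r ?oppr0 ?mul0r // mulNr mulrA.
move=> /(_ par).
have ln2 : 0 < ln 2 :> R by rewrite ln_gt0 // ltr1n.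
have logE x y : 0 < x -> 0 < y -> log2 x - log2 y = (ln x - ln y) / ln 2 :> R.
  by move=> x0 y0; rewrite /log2 x0 y0 mulrBl.
rewrite -(pmulr_lge0 _ (x := (ln 2)^-1)) ?invr_gt0 // mulr_suml.
rewrite big_sumType /=.
rewrite -(pair_bigA _ (fun i j => c (inl (i, j)) *
  (ln (a (inl (i, j))) - ln (b (inl (i, j)))) / ln 2)) /=.
rewrite -[X in _ -> is_true X]subr_ge0; congr (0 <= _); rewrite -sumrN; congr (_ + _).
  apply: eq_bigr => i _; apply: eq_bigr => j _; rewrite -mulrA.
  rewrite -logE ?ap ?bp // /a /b /=.
  by have [->|//] := eqVneq (l i * w i j) 0; rewrite !mul0r.
apply: eq_bigr => k _; rewrite -mulrA -logE ?ap ?bp // /a /b /= oppr_eq0.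
by case: eqVneq => [->|_]; rewrite ?(mul0r, oppr0) // mulNr.
Qed.

End Measured.

(** * Spectral families and the matrix logarithm *)

Definition mxlog2 n (A : 'M[C]_n) : 'M[C]_n :=
  let U := spectralmx A in
  hadj U *m diag_mx (map_mx (fun z : C => (log2 (re z))%:C) (spectral_diag A)) *m U.

Lemma hadj_spectral n (A : 'M[C]_n) : hadj (spectralmx A) = invmx (spectralmx A).
Proof. by rewrite invmx_unitary ?spectral_unitarymx // /hadj map_trmx. Qed.

Lemma spectral_mulV n (A : 'M[C]_n) : spectralmx A *m hadj (spectralmx A) = 1%:M.
Proof. by rewrite hadj_spectral mulmxV // spectral_unit. Qed.

Lemma spectral_mulVl n (A : 'M[C]_n) : hadj (spectralmx A) *m spectralmx A = 1%:M.
Proof. by rewrite hadj_spectral mulVmx // spectral_unit. Qed.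

Lemma herm_hermsym n (A : 'M[C]_n) : hadj A = A -> A \is hermsymmx.
Proof.
by move=> hA; apply/is_hermitianmxP; rewrite expr0 scale1r -[LHS]hA /hadj map_trmx.
Qed.

Lemma spectralE n (A : 'M[C]_n) : hadj A = A ->
  A = hadj (spectralmx A) *m diag_mx (spectral_diag A) *m spectralmx A.
Proof.
move=> hA; rewrite hadj_spectral.
by apply/orthomx_spectralP/hermitian_normalmx/herm_hermsym.
Qed.

(* Both [A = \sum_k a k *: P k] and the spectral decomposition of [A] chosen by
   [spectralmx] diagonalise [A], so that the entry [(i, j)] of [U *m P k] is zero
   unless the [i]-th eigenvalue is [a k]. *)
Lemma mxlog2_projfam (I : finType) n (P : I -> 'M[C]_n) (a : I -> R) :
  projfam P -> mxlog2 (\sum_k (a k)%:C *: P k) = \sum_k (log2 (a k))%:C *: P k.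
Proof.
move=> famP; set A := \sum_k _; rewrite /mxlog2.
have hA : hadj A = A by exact: projfam_comb_herm.
have AE := spectralE hA.
have AP k : A *m P k = (a k)%:C *: P k by exact: projfam_comb_mull.
have VU := spectral_mulVl A; have UV := spectral_mulV A.
move: (spectralmx A) (spectral_diag A) AE VU UV => U D AE VU UV.
have DUP k : diag_mx D *m (U *m P k) = (a k)%:C *: (U *m P k).
  by rewrite scalemxAr -AP {1}AE !mulmxA UV mul1mx.
set L := diag_mx _.
have LUP k : L *m (U *m P k) = (log2 (a k))%:C *: (U *m P k).
  move: (DUP k); set B := U *m P k; rewrite /L !mul_diag_mx.
  move=> /matrixP DB; apply/matrixP => i j; move/(_ i j): DB; rewrite !mxE.
  move=> /eqP; rewrite -subr_eq0 -mulrBl mulf_eq0 subr_eq0.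
  by move=> /orP[/eqP -> |/eqP ->]; rewrite ?mulr0 ?ofRK.
case: famP => _ _ P1.
rewrite -[LHS]mulmx1 -P1 mulmx_sumr; apply: eq_bigr => k _.
by rewrite -!mulmxA LUP -scalemxAr mulmxA VU mul1mx.
Qed.

(** The family consists of the projections on the eigenvectors, the columns of [hadj U]. The last
    clause, witnessed by the same columns, lets the sign of an eigenvalue be read off the quadratic
    form. *)
Lemma spectral_projfam n (A : 'M[C]_n) : hadj A = A ->
  exists (E : 'I_n -> 'M[C]_n) (l : 'I_n -> R),
  [/\ projfam E, forall i, rtr (E i) = 1, A = \sum_i (l i)%:C *: E i
    & forall i, exists v : 'cV[C]_n, (l i)%:C = (hadj v *m A *m v) 0 0].
Proof.
move=> hA; have AE := spectralE hA.
have /mxOverP Dr := hermitian_spectral_diag_real (herm_hermsym hA).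
have VU := spectral_mulVl A; have UV := spectral_mulV A.
move: (spectralmx A) (spectral_diag A) AE VU UV Dr => U D AE VU UV Dr.
pose E i := hadj U *m delta_mx i i *m U.
have re_D i : (re (D 0 i))%:C = D 0 i by rewrite re_Re; exact/Creal_ReP/Dr.
exists E, (fun i => re (D 0 i)); split.
- split.
  + move=> i; rewrite /E !hadjM hadjK mulmxA; congr (_ *m _ *m _).
    by apply/matrixP => j k; rewrite !mxE andbC conjC_nat.
  + move=> i j; rewrite /E !mulmxA -(mulmxA _ U) UV mulmx1 -(mulmxA (hadj U)).
    case: eqVneq => [->|ij]; first by rewrite mul_delta_mx.
    by rewrite mul_delta_mx_0 // mulmx0 mul0mx.
  + by rewrite -mulmx_suml -mulmx_sumr -mx1_sum_delta mulmx1.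
- move=> i; rewrite rtrC mulmxA UV mul1mx /rtr /mxtrace (bigD1 i) //= big1 => [|j ji].
    by rewrite !mxE !eqxx addr0 -(rmorph1 ofR) ofRK.
  by rewrite mxE (negPf ji).
- rewrite {1}AE diag_mx_sum_delta mulmx_sumr mulmx_suml.
  by apply: eq_bigr => i _; rewrite re_D -scalemxAr -scalemxAl.
- move=> i; exists (hadj U *m delta_mx i 0); rewrite re_D {1}AE hadjM hadjK.
  rewrite !mulmxA -(mulmxA _ U) UV mulmx1 -(mulmxA _ U) UV mulmx1.
  have -> : hadj (delta_mx i 0 : 'cV[C]_n) = delta_mx 0 i.
    by apply/matrixP => j k; rewrite !mxE andbC conjC_nat.
  by rewrite -rowE -colE !mxE eqxx mulr1n.
Qed.

Lemma rank1_mulmxE (F : fieldType) n (P : 'M[F]_n) : \rank P = 1%N ->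
  exists (c : 'cV[F]_n) (r : 'rV[F]_n), P = c *m r.
Proof.
move=> P1; have := mulmx_base P; move: (col_base P) (row_base P).
by rewrite P1 => c r <-; exists c, r.
Qed.

Lemma outer_sandwich n (c : 'cV[C]_n) (r : 'rV[C]_n) (A : 'M[C]_n) :
  c *m r *m A *m (c *m r) = \tr (c *m r *m A) *: (c *m r).
Proof.
rewrite -!mulmxA mxtrace_mulC -!mulmxA (mulmxA A) (mulmxA r).
by rewrite [r *m (A *m c)]mx11_scalar mul_scalar_mx mxtrace_scalar mulr1n -scalemxAr.
Qed.

(** The form in which rank one enters: it makes a pinched operator diagonal in the measured family,
    with the outcome probabilities as eigenvalues. *)
Definition sandwich_scalar n (P : 'M[C]_n) : Prop :=
  forall A, P *m A *m P = \tr (P *m A) *: P.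

Definition mxpinch (I : finType) n (P : I -> 'M[C]_n) (A : 'M[C]_n) : 'M[C]_n :=
  \sum_k P k *m A *m P k.

Lemma mxpinchE (I : finType) n (P : I -> 'M[C]_n) (A : 'M[C]_n) :
  projfam P -> (forall k, sandwich_scalar (P k)) -> hadj A = A ->
  mxpinch P A = \sum_k (rtr (P k *m A))%:C *: P k.
Proof.
move=> [hP _ _] sP hA; apply: eq_bigr => k _.
by rewrite sP mxtrace_hermM.
Qed.

(** The cross term of the relative entropy to the pinched state is minus the Shannon entropy of the
    outcomes. *)
Lemma rtr_mxlog2_pinch (I : finType) n (P : I -> 'M[C]_n) (A : 'M[C]_n) :
  projfam P -> (forall k, sandwich_scalar (P k)) -> hadj A = A ->
  rtr (A *m mxlog2 (mxpinch P A)) =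
  \sum_k rtr (P k *m A) * log2 (rtr (P k *m A)).
Proof.
move=> famP sP hA; rewrite mxpinchE // mxlog2_projfam // rtrC rtr_comb_mul.
by apply: eq_bigr => k _; rewrite mulrC.
Qed.

Lemma rtr_comb_mxlog2 (I : finType) n (E : I -> 'M[C]_n) (l : I -> R) :
  projfam E -> (forall i, rtr (E i) = 1) ->
  let A := \sum_i (l i)%:C *: E i in rtr (A *m mxlog2 A) = \sum_i l i * log2 (l i).
Proof.
move=> famE E1 A; rewrite mxlog2_projfam // rtrC rtr_comb_mul.
apply: eq_bigr => i _; rewrite rtrC projfam_comb_mull //.
by rewrite rtrZ E1 mulr1 mulrC.
Qed.

(** Split [v] into the components [P k *m v]. If one of them is nonzero, outcome [k] has probability
    zero. That probability is the sum of the [l i * hs (E i *m P k)], so every term vanishes and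
    [A *m P k = 0]. *)
Lemma pinch_supp (I J : finType) n (E : I -> 'M[C]_n) (l : I -> R)
  (P : J -> 'M[C]_n) (v : 'cV[C]_n) :
  projfam E -> (forall i, 0 <= l i) -> projfam P ->
  (forall k, sandwich_scalar (P k)) ->
  let A := \sum_i (l i)%:C *: E i in
  mxpinch P A *m v = 0 -> A *m v = 0.
Proof.
move=> famE l0 famP sP A.
have hA : hadj A = A by exact: projfam_comb_herm.
have hE i : hadj (E i) = E i by case: famE.
have hP k : hadj (P k) = P k by case: famP.
rewrite mxpinchE // => Pv0.
(* The pinched operator commutes with [P k], so each component of [v] lies in its kernel too. *)
have {Pv0} pPv k : (rtr (P k *m A))%:C *: (P k *m v) = 0.
  rewrite scalemxAl -(projfam_comb_mull famP (fun k => (rtr (P k *m A))%:C)).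
  have -> : (\sum_i (rtr (P i *m A))%:C *: P i) *m P k =
            P k *m (\sum_i (rtr (P i *m A))%:C *: P i).
    by rewrite -[RHS]hadjK hadjM hP projfam_comb_herm // projfam_comb_mull // hadjZ hP.
  by rewrite -mulmxA Pv0 mulmx0.
have -> : v = \sum_k P k *m v by case: famP => _ _ P1; rewrite -mulmx_suml P1 mul1mx.
rewrite mulmx_sumr; apply: big1 => k _.
move: (pPv k) => /eqP; rewrite scaler_eq0 => /orP[|/eqP ->]; last by rewrite mulmx0.
rewrite fmorph_eq0 rtrC rtr_comb_mul.
rewrite psumr_eq0 => [/allP lE0|i _]; last first.
  by rewrite mulr_ge0 // rtr_proj_ge0 ?hs_ge0 ?projfam_idem.
rewrite mulmxA /A mulmx_suml big1 ?mul0mx // => i _.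
have := lE0 i (mem_index_enum i).
rewrite rtr_proj_ge0 ?projfam_idem // mulf_eq0 -scalemxAl => /orP[/eqP ->|/eqP/hs_eq0 ->].
  by rewrite rmorph0 scale0r.
by rewrite scaler0.
Qed.

(** Where [m i j] is positive both marginals are positive and the logarithm of their product splits;
    elsewhere the weight is zero. *)
Lemma sum_log2_marginals (I J : finType) (m : I -> J -> R) :
  (forall i j, 0 <= m i j) ->
  \sum_i \sum_j m i j * log2 ((\sum_j' m i j') * (\sum_i' m i' j)) =
  \sum_i (\sum_j m i j) * log2 (\sum_j m i j) +
  \sum_j (\sum_i m i j) * log2 (\sum_i m i j).
Proof.
move=> m0.
under [in RHS]eq_bigr do rewrite mulr_suml.
under [X in _ = _ + X]eq_bigr do rewrite mulr_suml.
rewrite [X in _ = _ + X]exchange_big -big_split /=; apply: eq_bigr => i _.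
rewrite -big_split /=; apply: eq_bigr => j _; rewrite -mulrDr.
have [->|mij] := eqVneq (m i j) 0; first by rewrite !mul0r.
have mp : 0 < m i j by rewrite lt_neqAle eq_sym mij m0.
have a0 : 0 < \sum_j' m i j'.
  by apply: lt_le_trans mp _; rewrite (bigD1 j) //= lerDl sumr_ge0.
have b0 : 0 < \sum_i' m i' j.
  by apply: lt_le_trans mp _; rewrite (bigD1 i) //= lerDl sumr_ge0.
by rewrite /log2 mulr_gt0 // a0 b0 lnM ?posrE // mulrDl.
Qed.

(** * Tensor products and partial traces *)

Section Tensor.
Variables (N : nat) (d : 'I_N -> nat).
Implicit Types g A : {set 'I_N}.

Lemma res_eqP A (x y : FullB d) :
  reflect (forall i, i \in A -> x i = y i) (res A x == res A y).
Proof.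
apply: (iffP eqP) => [xy i iA|xy].
  by have /ffunP/(_ (exist _ i iA)) := xy; rewrite !ffunE.
by apply/ffunP => -[i iA]; rewrite !ffunE xy.
Qed.

Lemma res_eqCC A (x y : FullB d) :
  (res (~: ~: A) x == res (~: ~: A) y) = (res A x == res A y).
Proof.
by apply/res_eqP/res_eqP => xy i iA; apply: xy; move: iA; rewrite finset.setCK.
Qed.

Lemma res_eq2 g (x y : FullB d) :
  (res g x == res g y) && (res (~: g) x == res (~: g) y) = (x == y).
Proof.
apply/andP/eqP => [[/res_eqP xy /res_eqP xy']|-> //].
apply/ffunP => i; have [ig|ig] := boolP (i \in g); first exact: xy.
by apply: xy'; rewrite inE.
Qed.

(** The inverse of the pair of restrictions. Matching on [boolP] supplies the membership proof that
    indexes [a] or [b]. *)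
Definition glue g (a : SubB d g) (b : SubB d (~: g)) : FullB d :=
  [ffun i => match boolP (i \in g) with
             | AltTrue ig => a (exist _ i ig)
             | AltFalse ig => b (exist _ i (etrans (finset.in_setC i g) ig))
             end].

Lemma res_glue g a b : res g (@glue g a b) = a.
Proof.
apply/ffunP => -[i ig]; rewrite !ffunE /=.
case: {-}_ / (boolP (i \in g)) => ig'; last by exfalso; move: ig' => /negP.
by congr (a (exist _ _ _)); exact: bool_irrelevance.
Qed.

Lemma res_glueC g a b : res (~: g) (@glue g a b) = b.
Proof.
apply/ffunP => -[i ig]; rewrite !ffunE /=.
case: {-}_ / (boolP (i \in g)) => ig'; last by congr (b (exist _ _ _)); exact: bool_irrelevance.
by exfalso; move: ig; rewrite inE ig'.
Qed.

Lemma big_res g (V : nmodType) (F : SubB d g -> SubB d (~: g) -> V) :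
  \sum_(x : FullB d) F (res g x) (res (~: g) x) = \sum_a \sum_b F a b.
Proof.
rewrite pair_bigA /= (reindex (fun p : SubB d g * SubB d (~: g) => glue p.1 p.2)) /=.
  by apply: eq_bigr => -[a b] _; rewrite res_glue res_glueC.
exists (fun x => (res g x, res (~: g) x)) => [[a b]|x] _ /=.
  by rewrite res_glue res_glueC.
by apply/eqP; rewrite -(res_eq2 g) res_glue res_glueC !eqxx.
Qed.

Lemma big_enum_ord (T : finType) (V : nmodType) (F : T -> V) :
  \sum_(i < #|{: T}|) F (enum_val i) = \sum_x F x.
Proof. by rewrite -(@big_enum_val _ _ _ T {: T}). Qed.

Lemma big_dimF g (V : nmodType) (F : 'I_(dimS d g) -> 'I_(dimS d (~: g)) -> V) :
  \sum_(k < dimF d) F (enum_rank (res g (enum_val k))) (enum_rank (res (~: g) (enum_val k)))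
  = \sum_i \sum_j F i j.
Proof.
rewrite (big_enum_ord (fun x => F (enum_rank (res g x)) (enum_rank (res (~: g) x)))).
rewrite (big_res (fun a b => F (enum_rank a) (enum_rank b))).
rewrite -(big_enum_ord (fun a => \sum_b F (enum_rank a) (enum_rank b))).
apply: eq_bigr => i _; rewrite enum_valK.
rewrite -(big_enum_ord (fun b => F i (enum_rank b))).
by apply: eq_bigr => j _; rewrite enum_valK.
Qed.

Definition mxtens g (X : 'M[C]_(dimS d g)) (Y : 'M[C]_(dimS d (~: g)))
  : 'M[C]_(dimF d) :=
  \matrix_(i, j)
    (X (enum_rank (res g (enum_val i))) (enum_rank (res g (enum_val j))) *
     Y (enum_rank (res (~: g) (enum_val i))) (enum_rank (res (~: g) (enum_val j)))).

Definition mxptrace A (rho : 'M[C]_(dimF d)) : 'M[C]_(dimS d A) :=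
  \matrix_(a, b)
    \sum_(x : FullB d) \sum_(y : FullB d |
        [&& res A x == enum_val a, res A y == enum_val b & res (~: A) x == res (~: A) y])
      rho (enum_rank x) (enum_rank y).

Section Bipartite.
Variable g : {set 'I_N}.
Implicit Types (X : 'M[C]_(dimS d g)) (Y : 'M[C]_(dimS d (~: g))).

Lemma mxtensM X X' Y Y' :
  mxtens X Y *m mxtens X' Y' = mxtens (X *m X') (Y *m Y').
Proof.
apply/matrixP => i j; rewrite !mxE.
under eq_bigr do rewrite !mxE.
set ri := enum_rank (res g (enum_val i)); set ri' := enum_rank (res (~: g) (enum_val i)).
set rj := enum_rank (res g (enum_val j)); set rj' := enum_rank (res (~: g) (enum_val j)).
rewrite (big_dimF (fun a b => X ri a * Y ri' b * (X' a rj * Y' b rj'))).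
rewrite mulr_suml; apply: eq_bigr => a _; rewrite mulr_sumr; apply: eq_bigr => b _.
by rewrite mulrACA.
Qed.

Lemma mxtrace_mxtens X Y : \tr (mxtens X Y) = \tr X * \tr Y.
Proof.
rewrite /mxtrace; under eq_bigr do rewrite mxE.
rewrite (big_dimF (fun a b => X a a * Y b b)) mulr_suml.
by apply: eq_bigr => a _; rewrite mulr_sumr.
Qed.

Lemma hadj_mxtens X Y : hadj (mxtens X Y) = mxtens (hadj X) (hadj Y).
Proof. by apply/matrixP => i j; rewrite !mxE rmorphM. Qed.

Lemma mxtens1 : mxtens (1%:M : 'M[C]_(dimS d g)) 1%:M = 1%:M.
Proof.
apply/matrixP => i j; rewrite !mxE -natrM mulnb.
rewrite !(inj_eq enum_rank_inj) (res_eq2 g).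
by rewrite (inj_eq enum_val_inj).
Qed.

Lemma mxtens_comb (J K : finType) (a : J -> C) (b : K -> C)
  (F : J -> 'M[C]_(dimS d g)) (G : K -> 'M[C]_(dimS d (~: g))) :
  mxtens (\sum_j a j *: F j) (\sum_k b k *: G k) =
  \sum_(p : J * K) (a p.1 * b p.2) *: mxtens (F p.1) (G p.2).
Proof.
apply/matrixP => i j; rewrite !mxE !summxE -(pair_bigA _ (fun u v =>
  ((a u * b v) *: mxtens (F u) (G v)) i j)) /= mulr_suml.
apply: eq_bigr => u _; rewrite mulr_sumr; apply: eq_bigr => v _.
by rewrite !mxE mulrACA.
Qed.

Lemma projfam_mxtens (J K : finType)
  (F : J -> 'M[C]_(dimS d g)) (G : K -> 'M[C]_(dimS d (~: g))) :
  projfam F -> projfam G ->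
  projfam (fun p : J * K => mxtens (F p.1) (G p.2)).
Proof.
move=> [hF oF F1] [hG oG G1]; split.
- by move=> p; rewrite hadj_mxtens hF hG.
- move=> [i j] [i' j'] /=; rewrite mxtensM oF oG xpair_eqE.
  by do 2 case: eqP => _ //=; apply/matrixP => x y; rewrite !mxE ?mul0r ?mulr0.
- rewrite -mxtens1 -F1 -G1.
  under [\sum_k F k]eq_bigr do rewrite -[F _]scale1r.
  under [\sum_k G k]eq_bigr do rewrite -[G _]scale1r.
  by rewrite mxtens_comb; apply: eq_bigr => p _; rewrite mulr1 scale1r.
Qed.

Lemma mxtens_outer (c : 'cV[C]_(dimS d g)) (r : 'rV[C]_(dimS d g))
  (c' : 'cV[C]_(dimS d (~: g))) (r' : 'rV[C]_(dimS d (~: g))) :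
  exists (c2 : 'cV[C]_(dimF d)) (r2 : 'rV[C]_(dimF d)), mxtens (c *m r) (c' *m r') = c2 *m r2.
Proof.
exists (\col_i (c (enum_rank (res g (enum_val i))) 0 * c' (enum_rank (res (~: g) (enum_val i))) 0)).
exists (\row_i (r 0 (enum_rank (res g (enum_val i))) * r' 0 (enum_rank (res (~: g) (enum_val i))))).
by apply/matrixP => i j; rewrite !mxE !big_ord1 !mxE mulrACA.
Qed.

End Bipartite.

(* [X] on the subsystem [A], identity on its complement; unlike [mxtens X 1%:M]
   it also covers the case [A = ~: g], where [~: A] is not syntactically [g]. *)
Definition mxlift A (X : 'M[C]_(dimS d A)) : 'M[C]_(dimF d) :=
  \matrix_(i, j) (X (enum_rank (res A (enum_val i))) (enum_rank (res A (enum_val j)))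
    *+ (res (~: A) (enum_val i) == res (~: A) (enum_val j))).

Lemma mxlift_l g (X : 'M[C]_(dimS d g)) : mxlift X = mxtens X 1%:M.
Proof.
by apply/matrixP => i j; rewrite !mxE (inj_eq enum_rank_inj) mulr_natr.
Qed.

Lemma mxlift_r g (Y : 'M[C]_(dimS d (~: g))) : mxlift Y = mxtens 1%:M Y.
Proof.
by apply/matrixP => i j; rewrite !mxE (inj_eq enum_rank_inj) res_eqCC mulr_natl.
Qed.

(** The partial trace is adjoint to tensoring with the identity. All later facts on traces against
    marginals go through this duality. *)
Lemma mxtrace_mxptrace A (rho : 'M[C]_(dimF d)) (X : 'M[C]_(dimS d A)) :
  \tr (mxptrace A rho *m X) = \tr (rho *m mxlift X).
Proof.
transitivity (\sum_(x : FullB d) \sum_(y : FullB d | res (~: A) y == res (~: A) x)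
  rho (enum_rank x) (enum_rank y) * X (enum_rank (res A y)) (enum_rank (res A x))).
  rewrite /mxtrace; under eq_bigr do rewrite mxE.
  under eq_bigr do under eq_bigr do rewrite mxE mulr_suml.
  under eq_bigr do rewrite exchange_big.
  rewrite exchange_big /=; apply: eq_bigr => x _.
  (* For fixed [x] only the index of its restriction to [A] survives; the same holds for [y]
     below. *)
  rewrite (bigD1 (enum_rank (res A x))) //= [X in _ + X]big1 ?addr0 => [|a ax]; last first.
    apply: big1 => b _; rewrite big_pred0 ?mul0r // => y.
    by case: eqP => // xa; rewrite xa enum_valK eqxx in ax.
  under eq_bigr do rewrite mulr_suml big_mkcond /=.
  rewrite exchange_big /= [RHS]big_mkcond /=; apply: eq_bigr => y _.
  rewrite (bigD1 (enum_rank (res A y))) //= [X in _ + X]big1 ?addr0 => [|b yb].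
    by rewrite !enum_rankK !eqxx /= eq_sym.
  by rewrite enum_rankK eqxx; case: eqP => // yb'; rewrite yb' enum_valK eqxx in yb.
rewrite /mxtrace -(big_enum_ord (T := FullB d)); apply: eq_bigr => i _.
rewrite mxE big_mkcond /= -(big_enum_ord (T := FullB d)); apply: eq_bigr => j _.
by rewrite !enum_valK mxE; case: eqP => _; rewrite ?mulr1n ?mulr0n ?mulr0.
Qed.

Lemma hadj_mxptrace A (rho : 'M[C]_(dimF d)) : hadj rho = rho ->
  hadj (mxptrace A rho) = mxptrace A rho.
Proof.
move=> hrho; apply/matrixP => a b; rewrite !mxE rmorph_sum.
under eq_bigr do rewrite rmorph_sum big_mkcond.
rewrite exchange_big /=; apply: eq_bigr => x _.
rewrite -big_mkcond /=; apply: eq_big => [y|y _].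
  by rewrite (eq_sym (res (~: A) y)) andbCA.
by rewrite -[rho in RHS]hrho !mxE.
Qed.

(** * Mutual information and discord *)

(** [ofR] is only known to be a ring morphism, so order is recovered from squares: for negative [a],
    [- a] is a square, hence nonnegative in [C], which forces [a = 0]. *)
Lemma ofR_ge0 (a : R) : 0 <= a%:C -> 0 <= a.
Proof.
move=> a0; rewrite leNgt; apply/negP => an.
have sq : (- a)%:C = (Num.sqrt (- a))%:C ^+ 2.
  by rewrite -rmorphXn /= sqr_sqrtr // oppr_ge0 ltW.
have : 0 <= (- a)%:C by rewrite sq real_exprn_even_ge0 ?ofR_real.
rewrite rmorphN oppr_ge0 => a0'; have /eqP : a%:C = 0 by apply/eqP; rewrite eq_le a0 a0'.
by rewrite fmorph_eq0 => /eqP a00; rewrite a00 ltxx in an.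
Qed.

Definition psd n (A : 'M[C]_n) : Prop :=
  hadj A = A /\ forall v : 'cV[C]_n, 0 <= (hadj v *m A *m v) 0 0.

Lemma psd_projfam n (A : 'M[C]_n) : psd A ->
  exists (E : 'I_n -> 'M[C]_n) (l : 'I_n -> R),
  [/\ projfam E, forall i, rtr (E i) = 1, forall i, 0 <= l i
    & A = \sum_i (l i)%:C *: E i].
Proof.
move=> [hA A0]; have [E [l [famE E1 AE lv]]] := spectral_projfam hA.
by exists E, l; split=> // i; apply: ofR_ge0; have [v ->] := lv i.
Qed.

Lemma rtr_psd_proj_ge0 n (Q A : 'M[C]_n) : psd A -> hadj Q = Q -> Q *m Q = Q ->
  0 <= rtr (Q *m A).
Proof. by move=> /psd_projfam[E [l [? ? ? ->]]] *; exact: rtr_proj_comb_ge0. Qed.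

(** By duality the eigenvalue [l i] is the trace of [rho] against the projection [E i] tensored with
    the identity, hence nonnegative. *)
Lemma mxptrace_projfam A (rho : 'M[C]_(dimF d)) : psd rho ->
  exists (E : 'I_(dimS d A) -> 'M[C]_(dimS d A)) (l : 'I_(dimS d A) -> R),
  [/\ projfam E, forall i, rtr (E i) = 1, forall i, 0 <= l i
    & mxptrace A rho = \sum_i (l i)%:C *: E i].
Proof.
move=> psd_rho; have hA := hadj_mxptrace A (proj1 psd_rho).
have [E [l [famE E1 AE _]]] := spectral_projfam hA.
exists E, l; split=> // i; have [hE _ _] := famE.
have -> : l i = rtr (mxptrace A rho *m E i).
  by rewrite AE projfam_comb_mull // rtrZ E1 mulr1.
rewrite /rtr mxtrace_mxptrace mxtrace_mulC mxlift_l.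
apply: rtr_psd_proj_ge0 => //; first by rewrite hadj_mxtens hE hadj1.
by rewrite mxtensM mulmx1 projfam_idem.
Qed.

Section Discord.
Variable g : {set 'I_N}.
Variable rho : 'M[C]_(dimF d).
Hypothesis psd_rho : psd rho.
Let rhoA := mxptrace g rho.
Let rhoB := mxptrace (~: g) rho.

(** Summing over a complete measurement of the other side replaces its factor by the identity. Local
    outcome probabilities are thus marginals of the joint ones. *)
Lemma rtr_marginal_l (K : finType) (X : 'M[C]_(dimS d g))
  (Q : K -> 'M[C]_(dimS d (~: g))) : projfam Q ->
  rtr (X *m rhoA) = \sum_k rtr (mxtens X (Q k) *m rho).
Proof.
move=> [_ _ Q1]; rewrite rtrC /rtr mxtrace_mxptrace mxtrace_mulC mxlift_l.
rewrite -[RHS](@rtr_sum _ K) -mulmx_suml; congr (re (\tr (_ *m _))).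
apply/matrixP => i j; rewrite -Q1 !mxE !summxE mulr_sumr.
by apply: eq_bigr => k _; rewrite mxE.
Qed.

Lemma rtr_marginal_r (K : finType) (Y : 'M[C]_(dimS d (~: g)))
  (P : K -> 'M[C]_(dimS d g)) : projfam P ->
  rtr (Y *m rhoB) = \sum_k rtr (mxtens (P k) Y *m rho).
Proof.
move=> [_ _ P1]; rewrite rtrC /rtr mxtrace_mxptrace mxtrace_mulC mxlift_r.
rewrite -[RHS](@rtr_sum _ K) -mulmx_suml; congr (re (\tr (_ *m _))).
apply/matrixP => i j; rewrite -P1 !mxE !summxE mulr_suml.
by apply: eq_bigr => k _; rewrite mxE.
Qed.

Variables K L : finType.
Variables (P : K -> 'M[C]_(dimS d g)) (Q : L -> 'M[C]_(dimS d (~: g))).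
Hypotheses (famP : projfam P) (famQ : projfam Q).

Let T (t : K * L) := mxtens (P t.1) (Q t.2).

(** Mutual information is the relative entropy to the product of the marginals.
    [measured_relative_entropy_le] is used with sigma equal to [mxtens rhoA rhoB], diagonalised by
    [H] with eigenvalues [a t.1 * b t.2], and with the product measurement [T]. *)
Lemma measured_mutual_information_le :
  \sum_t rtr (T t *m rho) * log2 (rtr (T t *m rho))
  - \sum_k rtr (P k *m rhoA) * log2 (rtr (P k *m rhoA))
  - \sum_k rtr (Q k *m rhoB) * log2 (rtr (Q k *m rhoB))
  <= rtr (rho *m mxlog2 rho) - rtr (rhoA *m mxlog2 rhoA) - rtr (rhoB *m mxlog2 rhoB).
Proof.
have [E [l [famE E1 l0 rhoE]]] := psd_projfam psd_rho.
have [F [a [famF F1 a0 rhoAE]]] := mxptrace_projfam g psd_rho.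
have [G [b [famG G1 b0 rhoBE]]] := mxptrace_projfam (~: g) psd_rho.
have famT : projfam T by exact: projfam_mxtens.
pose H (t : 'I_(dimS d g) * 'I_(dimS d (~: g))) := mxtens (F t.1) (G t.2).
have famH : projfam H by exact: projfam_mxtens.
have prodE : mxtens rhoA rhoB = \sum_t (a t.1 * b t.2)%:C *: H t.
  rewrite /rhoA /rhoB rhoAE rhoBE mxtens_comb.
  by apply: eq_bigr => t _; rewrite rmorphM.
have hrA : hadj rhoA = rhoA by apply: hadj_mxptrace; case: psd_rho.
have hrB : hadj rhoB = rhoB by apply: hadj_mxptrace; case: psd_rho.
have pos (J : finType) (U : J -> 'M[C]_(dimF d)) j : projfam U -> 0 <= rtr (U j *m rho).
  by move=> famU; apply: rtr_psd_proj_ge0; rewrite ?projfam_idem //; case: famU.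
have qE t : rtr (T t *m mxtens rhoA rhoB) = rtr (P t.1 *m rhoA) * rtr (Q t.2 *m rhoB).
  case: famP famQ => hP _ _ [hQ _ _].
  rewrite mxtensM {1}/rtr mxtrace_mxtens !mxtrace_hermM //.
  by rewrite -rmorphM ofRK.
(* [a] and [b] are the marginals of the distribution [rtr (H t *m rho)]. This gives the support
   condition and lets the logarithm of [a t.1 * b t.2] split on the quantum side. *)
have aE j : a j = \sum_j' rtr (mxtens (F j) (G j') *m rho).
  rewrite -(rtr_marginal_l _ famG) rtrC /rhoA rhoAE projfam_comb_mull //.
  by rewrite rtrZ F1 mulr1.
have bE j : b j = \sum_j' rtr (mxtens (F j') (G j) *m rho).
  rewrite -(rtr_marginal_r _ famF) rtrC /rhoB rhoBE projfam_comb_mull //.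
  by rewrite rtrZ G1 mulr1.
have rtrH t : rtr (H t *m rho) = \sum_i l i * rtr (E i *m H t).
  by rewrite rtrC rhoE rtr_comb_mul.
have marg_gt0 (J1 J2 : finType) (m : J1 -> J2 -> R) i j :
    (forall i j, 0 <= m i j) -> m i j != 0 -> \sum_j' m i j' != 0 /\ \sum_i' m i' j != 0.
  move=> m0 mij; split.
    by rewrite psumr_eq0 //; apply/allPn; exists j; rewrite ?mem_index_enum.
  by rewrite psumr_eq0 //; apply/allPn; exists i; rewrite ?mem_index_enum.
have mle := @measured_relative_entropy_le _ _ _ _ E H T l (fun t => a t.1 * b t.2)
  famE famH famT l0 (fun t => mulr_ge0 (a0 _) (b0 _)).
rewrite -prodE -rhoE in mle.
have le1 : \sum_t rtr (T t *m rho) *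
      (log2 (rtr (T t *m rho)) - log2 (rtr (P t.1 *m rhoA) * rtr (Q t.2 *m rhoB))) <=
    \sum_i \sum_t l i * rtr (E i *m H t) * (log2 (l i) - log2 (a t.1 * b t.2)).
  under eq_bigr do rewrite -qE.
  (* Both support conditions hold because a joint probability that is nonzero has nonzero
     marginals. *)
  apply: mle => [i [j j']|[k k']].
    move=> w0 li0 /=; rewrite aE bE mulf_neq0 //.
      have [] := marg_gt0 _ _ (fun j j' => rtr (H (j, j') *m rho)) j j' => //.
        by move=> *; exact: pos.
      rewrite rtrH psumr_eq0 => [|i' _]; last first.
        by rewrite mulr_ge0 // rtr_proj_ge0 ?hs_ge0 ?projfam_idem //; [case: famE|case: famH].
      by apply/allPn; exists i; rewrite ?mem_index_enum // mulf_neq0.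
    have [] := marg_gt0 _ _ (fun j j' => rtr (H (j, j') *m rho)) j j' => //.
      by move=> *; exact: pos.
    rewrite rtrH psumr_eq0 => [|i' _]; last first.
      by rewrite mulr_ge0 // rtr_proj_ge0 ?hs_ge0 ?projfam_idem //; [case: famE|case: famH].
    by apply/allPn; exists i; rewrite ?mem_index_enum // mulf_neq0.
  move=> p0; rewrite qE /= (rtr_marginal_l _ famQ) (rtr_marginal_r _ famP).
  have [] := marg_gt0 _ _ (fun j j' => rtr (T (j, j') *m rho)) k k' => //.
    by move=> *; exact: pos.
  by move=> *; rewrite mulf_neq0.
have lhsE : \sum_t rtr (T t *m rho) *
      (log2 (rtr (T t *m rho)) - log2 (rtr (P t.1 *m rhoA) * rtr (Q t.2 *m rhoB))) =
    \sum_t rtr (T t *m rho) * log2 (rtr (T t *m rho))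
    - \sum_k rtr (P k *m rhoA) * log2 (rtr (P k *m rhoA))
    - \sum_k rtr (Q k *m rhoB) * log2 (rtr (Q k *m rhoB)).
  under eq_bigr do rewrite mulrBr.
  rewrite sumrB -addrA -opprD; congr (_ - _).
  under [in RHS]eq_bigr do rewrite (rtr_marginal_l _ famQ).
  under [X in _ = _ + X]eq_bigr do rewrite (rtr_marginal_r _ famP).
  rewrite -(sum_log2_marginals (m := fun k k' => rtr (T (k, k') *m rho))) => [|*]; last exact: pos.
  rewrite pair_bigA /=; apply: eq_bigr => -[k k'] _ /=.
  by rewrite (rtr_marginal_l _ famQ) (rtr_marginal_r _ famP).
have rhsE : \sum_i \sum_t l i * rtr (E i *m H t) * (log2 (l i) - log2 (a t.1 * b t.2)) =
    \sum_i l i * log2 (l i) - \sum_j a j * log2 (a j) - \sum_j b j * log2 (b j).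
  under eq_bigr do under eq_bigr do rewrite mulrBr.
  under eq_bigr do rewrite sumrB.
  rewrite sumrB -addrA -opprD; congr (_ - _).
    apply: eq_bigr => i _; rewrite -mulr_suml -mulr_sumr.
    under eq_bigr do rewrite rtrC.
    by rewrite -(rtr_projfam famH) E1 mulr1.
  under [in RHS]eq_bigr do rewrite aE.
  under [X in _ = _ + X]eq_bigr do rewrite bE.
  rewrite -(sum_log2_marginals (m := fun k k' => rtr (H (k, k') *m rho))) => [|*]; last exact: pos.
  rewrite exchange_big [RHS]pair_bigA /=; apply: eq_bigr => -[k k'] _ /=.
  by rewrite -mulr_suml -rtrH aE bE.
rewrite lhsE rhsE in le1.
have -> : rtr (rho *m mxlog2 rho) = \sum_i l i * log2 (l i).
  by rewrite rhoE rtr_comb_mxlog2.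
have -> : rtr (rhoA *m mxlog2 rhoA) = \sum_j a j * log2 (a j).
  by rewrite /rhoA rhoAE rtr_comb_mxlog2.
by have -> : rtr (rhoB *m mxlog2 rhoB) = \sum_j b j * log2 (b j)
  by rewrite /rhoB rhoBE rtr_comb_mxlog2.
Qed.

Hypothesis rankP : forall k, \rank (P k) = 1%N.
Hypothesis rankQ : forall k, \rank (Q k) = 1%N.

Lemma sandwich_rank1 n (X : 'M[C]_n) : \rank X = 1%N -> sandwich_scalar X.
Proof. by move=> /rank1_mulmxE[c [r ->]] A; exact: outer_sandwich. Qed.

Lemma sandwich_mxtens t : sandwich_scalar (T t).
Proof.
have [[c [r Pt]] [c' [r' Qt]]] :=
  (rank1_mulmxE (rankP t.1), rank1_mulmxE (rankQ t.2)).
have [c2 [r2 TE]] := mxtens_outer c r c' r'.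
by move=> A; rewrite /T Pt Qt TE outer_sandwich.
Qed.

(** Products of rank-one projections again satisfy [sandwich_scalar], so all three pinched
    logarithms reduce to outcome entropies; what remains is the mutual information inequality
    rearranged. *)
Lemma discord_real_ge0 :
  rtr (rhoA *m (mxlog2 rhoA - mxlog2 (mxpinch P rhoA)))
  + rtr (rhoB *m (mxlog2 rhoB - mxlog2 (mxpinch Q rhoB)))
  <= rtr (rho *m (mxlog2 rho - mxlog2 (\sum_k \sum_k' T (k, k') *m rho *m T (k, k')))).
Proof.
have hrho : hadj rho = rho by case: psd_rho.
have -> : \sum_k \sum_k' T (k, k') *m rho *m T (k, k') = mxpinch T rho.
  by rewrite pair_bigA; apply: eq_bigr => -[].
have arith (x y z x' y' z' : R) :
    x - y - z <= x' - y' - z' -> (y' - y) + (z' - z) <= x' - x by lra.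
have hrA : hadj rhoA = rhoA by exact: hadj_mxptrace.
have hrB : hadj rhoB = rhoB by exact: hadj_mxptrace.
have := measured_mutual_information_le.
rewrite -(rtr_mxlog2_pinch famP (fun k => sandwich_rank1 (rankP k)) hrA).
rewrite -(rtr_mxlog2_pinch famQ (fun k => sandwich_rank1 (rankQ k)) hrB).
rewrite -(rtr_mxlog2_pinch (projfam_mxtens famP famQ) sandwich_mxtens hrho).
by rewrite !mulmxBr !rtrB; exact: arith.
Qed.

End Discord.

Lemma mxptrace_pinch_supp A (rho : 'M[C]_(dimF d)) (K : finType)
  (P : K -> 'M[C]_(dimS d A)) (v : 'cV[C]_(dimS d A)) :
  psd rho -> projfam P -> (forall k, \rank (P k) = 1%N) ->
  mxpinch P (mxptrace A rho) *m v = 0 -> mxptrace A rho *m v = 0.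
Proof.
move=> psd_rho famP rankP.
have [E [l [famE _ l0 ->]]] := mxptrace_projfam A psd_rho.
by apply: pinch_supp => // k; exact: sandwich_rank1.
Qed.

End Tensor.

End Matrices.

(** * Transfer to matrices over [R[i]] and extended reals *)

Section Discord.
Variables (R : realType) (N : nat) (d : 'I_N -> nat) (g : {set 'I_N}).
Variable rho : 'M[R[i]]_(dimF d).
Hypothesis density_rho : density rho.

Local Notation rc := (real_complex R : {rmorphism R -> R[i]}).
Let rcK : cancel rc (@complex.Re R). Proof. by []. Qed.
Let reE := @complexRe R.
Let imE := @complexIm R.

Lemma density_psd : psd rho.
Proof. by case: density_rho. Qed.

Lemma complete_projfam n m (P : 'I_m -> 'M[R[i]]_n) :
  complete_rank1_projs P -> projfam P.
Proof.
move=> [hP _ oP P1]; split=> [k|k l|//]; first by case: (hP k).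
by case: eqVneq => [<-|/oP//]; case: (hP k).
Qed.

(** The kernel of a pinched marginal lies in the kernel of the marginal, so this relative entropy is
    finite and may be subtracted safely. *)
Lemma rel_entropy_pinch A m (P : 'I_m -> 'M[R[i]]_(dimS d A)) :
  complete_rank1_projs P ->
  let rhoA := ptrace A rho in
  rel_entropy rhoA (pinch P rhoA) =
  (complex.Re (\tr (rhoA *m (mlog2 rhoA - mlog2 (pinch P rhoA)))))%:E.
Proof.
move=> cP rhoA; rewrite /rel_entropy asboolT // => v.
have [_ rankP _ _] := cP.
exact: (mxptrace_pinch_supp rcK reE imE density_psd (complete_projfam cP) rankP).
Qed.

Lemma discord_term_ge0 m m' (P : 'I_m -> 'M[R[i]]_(dimS d g))
  (Q : 'I_m' -> 'M[R[i]]_(dimS d (~: g))) :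
  complete_rank1_projs P -> complete_rank1_projs Q ->
  (0 <= discord_term P Q rho)%E.
Proof.
move=> cP cQ; rewrite /discord_term !rel_entropy_pinch // /rel_entropy.
(* Only the marginal terms are subtracted and they are finite, so an infinite
   [rel_entropy rho (pinch2 P Q rho)] is harmless. *)
case: asboolP => _; last exact: leey.
have [[_ rankP _ _] [_ rankQ _ _]] := (cP, cQ).
have := discord_real_ge0 rcK reE imE density_psd (complete_projfam cP)
  (complete_projfam cQ) rankP rankQ.
rewrite -!EFinB lee_fin => h; rewrite -addrA -opprD subr_ge0; exact: h.
Qed.

End Discord.

Theorem theorem1 (R : realType) (N : nat) (d : 'I_N -> nat)
  (rho : 'M[R[i]]_(dimF d)) :
  (2 <= N)%N -> density rho -> (0 <= gmqd rho)%E.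
Proof.
move=> _ density_rho; rewrite /gmqd.
(* The neutral value [+oo] of the minimum is nonnegative, and so is a minimum of nonnegative values;
   each infimum is then bounded below term by term. *)
apply: (big_ind (fun x => 0 <= x)%E) => [|x y x0 y0|g _]; first exact: leey.
  by rewrite le_min x0.
apply: le_ereal_inf_tmp => _ [m [m' [P [Q [cP cQ ->]]]]].
exact: discord_term_ge0.
Qed.
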